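(* There is an algorithm that, given a GS-tree $T$ over a set $C$ of $m$ candidates and a ranking $v\in\mathcal{L}(C)$, computes $\mathrm{swap}(\mathrm{GS}(T),v)$ in time $O(m^2)$.
   Context: $\mathcal{L}(C)$ is the set of all linear orders (rankings, votes) over $C$. The swap distance $\mathrm{swap}(u,v)$ is the number of unordered pairs of candidates whose relative order differs in $u$ and $v$. For a set of rankings $D$, $\mathrm{swap}(D,v)=\min_{u\in D}\mathrm{swap}(u,v)$. A GS-tree over $C$ is an ordered rooted tree in which each internal node has at least two children and whose leaves are labeled bijectively with the candidates in $C$. The frontier of such a tree is the ranking obtained by reading its leaves from left to right. $\mathrm{GS}(T)\subseteq\mathcal{L}(C)$ is the set of all rankings that are the frontier of $T$ or of a tree obtained from $T$ by reversing the order of the children of some of its nodes. *)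

(* Defs.v *)
From HB Require Import structures.
From mathcomp Require Import all_boot.

Set Implicit Arguments.
Unset Strict Implicit.
Unset Printing Implicit Defensive.

(* A ranking lists the candidates from best to worst; a duplicate-free sequence
   of length #|C| contains every element of C. *)
Definition ranking (C : finType) := {r : #|C|.-tuple C | uniq r}.

Definition ranking_seq (C : finType) (u : ranking C) : seq C := val u.

Definition above (C : finType) (u : ranking C) (a b : C) : bool :=
  index a (ranking_seq u) < index b (ranking_seq u).

Definition swap (C : finType) (u v : ranking C) : nat :=
  #|[set e : {set C} | [exists a, exists b,
      [&& e == [set a; b], above u a b & above v b a]]]|.

(* The default value 'C(#|C|, 2), the number of all pairs, bounds every swap
   distance, so that this is the minimum for every nonempty D. *)
Definition swap_set (C : finType) (D : {set ranking C}) (v : ranking C) : nat :=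
  \big[minn/'C(#|C|, 2)]_(u in D) swap u v.

Inductive tree (C : Type) : Type :=
  | Leaf of C
  | Node of seq (tree C).

Fixpoint frontier (C : Type) (T : tree C) : seq C :=
  match T with
  | Leaf c => [:: c]
  | Node ts => flatten (map (@frontier C) ts)
  end.

Fixpoint branching (C : Type) (T : tree C) : bool :=
  match T with
  | Leaf _ => true
  | Node ts => (1 < size ts) && all (@branching C) ts
  end.

Definition gs_tree (C : finType) (T : tree C) : bool :=
  [&& branching T, uniq (frontier T) & [forall c, c \in frontier T]].

(* All trees obtained from T by reversing the order of the children of some
   (possibly none) of its nodes; [choices] below lists the ways of making such
   a choice independently in each child. *)
Fixpoint reversals (C : Type) (T : tree C) : seq (tree C) :=
  match T with
  | Leaf c => [:: Leaf c]
  | Node ts =>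
      let choices :=
        foldr (fun t acc => [seq u :: us | u <- reversals t, us <- acc])
              [:: [::]] ts in
      [seq Node us | us <- choices] ++ [seq Node (rev us) | us <- choices]
  end.

Definition GS (C : finType) (T : tree C) : {set ranking C} :=
  [set u | has (fun T' => frontier T' == ranking_seq u) (reversals T)].

(* The model of computation is a word RAM, programmed in structured form: a
   fixed finite set of registers (those occurring in the program), a memory
   indexed by words, and unit cost for every assignment, write and test. Both
   registers and memory cells are indexed by nat. *)
Record state := State { reg : nat -> nat; mem : nat -> nat }.

Inductive expr :=
  | Const of nat
  | Add of nat & nat
  | Sub of nat & nat
  | Read of nat.

Inductive prog :=
  | Skip
  | Assign of nat & expr          (* R_x := e *)
  | Write of nat & nat            (* M[R_x] := R_y *)
  | Seq of prog & prog
  | If of nat & nat & prog & prog (* if R_x < R_y then p else q *)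
  | While of nat & nat & prog.    (* while R_x < R_y do p *)

Definition value (s : state) (e : expr) : nat :=
  match e with
  | Const n => n
  | Add x y => reg s x + reg s y
  | Sub x y => reg s x - reg s y
  | Read x => mem s (reg s x)
  end.

(* [exec W p s t s'] : started in s, the program p halts in s' after exactly t
   steps. Words range over 0, ..., W - 1, and there is no rule for an
   assignment that overflows, so that such a run does not count as halting. *)
Inductive exec (W : nat) : prog -> state -> nat -> state -> Prop :=
  | exec_skip s : exec W Skip s 1 s
  | exec_assign s x e : value s e < W ->
      exec W (Assign x e) s 1
        (State [eta reg s with x |-> value s e] (mem s))
  | exec_write s x y :
      exec W (Write x y) s 1
        (State (reg s) [eta mem s with reg s x |-> reg s y])
  | exec_seq s s1 s2 t1 t2 p q :
      exec W p s t1 s1 -> exec W q s1 t2 s2 ->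
      exec W (Seq p q) s (t1 + t2) s2
  | exec_if_true s s' t x y p q : reg s x < reg s y ->
      exec W p s t s' -> exec W (If x y p q) s t.+1 s'
  | exec_if_false s s' t x y p q : reg s y <= reg s x ->
      exec W q s t s' -> exec W (If x y p q) s t.+1 s'
  | exec_while_true s s1 s2 t1 t2 x y p : reg s x < reg s y ->
      exec W p s t1 s1 -> exec W (While x y p) s1 t2 s2 ->
      exec W (While x y p) s (t1 + t2).+1 s2
  | exec_while_false s x y p : reg s y <= reg s x ->
      exec W (While x y p) s 1 s.

(* Candidates are named 0, ..., m - 1 by [enum_rank]. A tree is written in
   preorder: a leaf as 0 followed by its name, an internal node as its number of
   children followed by their codes. *)
Fixpoint tree_code (C : finType) (T : tree C) : seq nat :=
  match T with
  | Leaf c => [:: 0; nat_of_ord (enum_rank c)]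
  | Node ts => size ts :: flatten (map (@tree_code C) ts)
  end.

Definition input (C : finType) (T : tree C) (v : ranking C) : seq nat :=
  #|C| :: [seq nat_of_ord (enum_rank c) | c <- ranking_seq v] ++ tree_code T.

Definition init (C : finType) (T : tree C) (v : ranking C) : state :=
  State (fun=> 0) (nth 0 (input T v)).

Definition output (s : state) : nat := reg s 0.

(* Main.v *)
(* Reversing the children of a node exchanges the inversions against v between
   leaves of different children of that node with the non-inversions, and leaves
   all other pairs alone. So the minimum is a sum over the nodes of the smaller of
   these two numbers, and no node's choice affects another's. The machine reads
   the preorder code with an explicit stack; each time a child of a node is
   complete, its leaves are compared with those of the earlier children. Every
   pair of leaves is compared once, at its lowest common ancestor. *)
Require Import Defs.
From HB Require Import structures.
From mathcomp Require Import all_boot.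
From mathcomp Require Import zify.
From Stdlib Require Import FunctionalExtensionality.

Set Implicit Arguments.
Unset Strict Implicit.
Unset Printing Implicit Defensive.

(** * Inversions and the minimum over reversals *)

(** The generated principle gives no hypothesis for the trees inside a list. The conjunction by
    [foldr] unfolds along [ts], so that an inner induction on the children can take it apart. *)
Definition tree_nested_ind (C : Type) (P : tree C -> Prop)
    (leafP : forall c, P (Leaf c))
    (nodeP : forall ts, foldr (fun t => and (P t)) True ts -> P (Node ts)) :
    forall t, P t :=
  fix F t := match t with
    | Leaf c => leafP c
    | Node ts => nodeP ts
        ((fix G us : foldr (fun t => and (P t)) True us :=
            match us with
            | [::] => I
            | u :: us' => conj (F u) (G us')
            end) ts)
    end.

Definition cross (s1 s2 : seq nat) : nat :=
  \sum_(x <- s1) \sum_(y <- s2) (y < x).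

Fixpoint invs (s : seq nat) : nat :=
  if s is x :: s' then \sum_(y <- s') (y < x) + invs s' else 0.

Lemma cross_cons x s1 s2 :
  cross (x :: s1) s2 = \sum_(y <- s2) (y < x) + cross s1 s2.
Proof. by rewrite /cross big_cons. Qed.

Lemma perm_cross s1 s1' s2 s2' :
  perm_eq s1 s1' -> perm_eq s2 s2' -> cross s1 s2 = cross s1' s2'.
Proof.
move=> p1 p2; rewrite /cross (perm_big _ p1) /=.
by apply: eq_bigr => x _; exact: perm_big.
Qed.

Lemma invs_cat s1 s2 : invs (s1 ++ s2) = invs s1 + invs s2 + cross s1 s2.
Proof.
elim: s1 => [|x s1 IH] /=; first by rewrite /cross big_nil addn0.
rewrite IH cross_cons big_cat /=; lia.
Qed.

Lemma cross_sym_le s1 s2 : cross s1 s2 + cross s2 s1 <= size s1 * size s2.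
Proof.
rewrite {2}/cross exchange_big /cross -big_split /=.
under eq_bigr do rewrite -big_split /=.
rewrite -sum1_size big_distrl /= leq_sum // => x _.
rewrite mul1n -sum1_size leq_sum // => y _.
by case: ltngtP.
Qed.

Lemma invs_le s : invs s <= size s * size s.
Proof.
elim: s => //= x s IH.
have: \sum_(y <- s) (y < x) <= size s.
  by rewrite -sum1_size leq_sum // => y _; case: (y < x).
nia.
Qed.

(* Number of inversions between different members of the list [L :: ls]. *)
Fixpoint fwd (L : seq nat) (ls : seq (seq nat)) : nat :=
  if ls is l :: ls' then cross L l + fwd (L ++ l) ls' else 0.

(* The same, when the order of [L :: ls] is reversed. *)
Fixpoint bwd (L : seq nat) (ls : seq (seq nat)) : nat :=
  if ls is l :: ls' then cross l L + bwd (L ++ l) ls' else 0.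

(** [cross] sees a list only as a multiset, so rearrangements inside the members change nothing. *)
Lemma perm_fwd L L' ls ls' : perm_eq L L' -> all2 perm_eq ls ls' ->
  fwd L ls = fwd L' ls'.
Proof.
elim: ls ls' L L' => [|l ls IH] [|l' ls'] //= L L' pL /andP[pl pls].
by rewrite (perm_cross pL pl) (IH ls' _ (L' ++ l')) // perm_cat.
Qed.

Lemma perm_bwd L L' ls ls' : perm_eq L L' -> all2 perm_eq ls ls' ->
  bwd L ls = bwd L' ls'.
Proof.
elim: ls ls' L L' => [|l ls IH] [|l' ls'] //= L L' pL /andP[pl pls].
by rewrite (perm_cross pl pL) (IH ls' _ (L' ++ l')) // perm_cat.
Qed.

Lemma all2_perm_refl (T : eqType) (ls : seq (seq T)) : all2 perm_eq ls ls.
Proof. by elim: ls => //= l ls ->; rewrite perm_refl. Qed.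

Lemma invs_flatten L ls :
  invs (L ++ flatten ls) = invs L + sumn (map invs ls) + fwd L ls.
Proof.
elim: ls L => [|l ls IH] L /=; first by rewrite cats0 !addn0.
rewrite catA IH invs_cat; lia.
Qed.

Lemma invs_flatten_rev L ls :
  invs (flatten (rev ls) ++ L) = invs L + sumn (map invs ls) + bwd L ls.
Proof.
elim: ls L => [|l ls IH] L /=; first by rewrite !addn0.
rewrite rev_cons flatten_rcons -catA IH.
(* Reversal puts [l] in front of [L], whereas [bwd] accumulates [L ++ l]; the two agree up to
   permutation. *)
have pC : perm_eq (l ++ L) (L ++ l) by rewrite perm_catC.
rewrite (perm_bwd pC (all2_perm_refl ls)) (invs_cat l L); lia.
Qed.

(** Telescoping of the squares of the accumulated length. It bounds both counters of a node, which
    must fit in a word. *)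
Lemma fwd_bwd_le L ls :
  fwd L ls + bwd L ls + size L * size L <=
    (size L + size (flatten ls)) * (size L + size (flatten ls)).
Proof.
elim: ls L => [|l ls IH] L /=; first by lia.
have := cross_sym_le L l; have := IH (L ++ l); rewrite !size_cat -!addnA.
move: (_ * (_ + (_ + _))) => n; nia.
Qed.

(** * Minimum inversion count of a tree *)

Section Cost.
Context (C : finType) (pos : C -> nat).

Definition leaves (t : tree C) : seq nat := map pos (frontier t).

Fixpoint cost (t : tree C) : nat :=
  match t with
  | Leaf _ => 0
  | Node ts => sumn (map cost ts) +
      minn (fwd [::] (map leaves ts)) (bwd [::] (map leaves ts))
  end.

Definition frontiers (t : tree C) : seq (seq C) := map (@frontier C) (reversals t).

Fixpoint choices (fs : seq (seq (seq C))) : seq (seq (seq C)) :=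
  if fs is f :: fs' then [seq u :: us | u <- f, us <- choices fs'] else [:: [::]].

(** Reversing a node permutes the blocks formed by its children but keeps each block intact, so
    frontiers can be chosen without the trees. *)
Lemma frontiers_node ts :
  frontiers (Node ts) =
    map flatten (choices (map frontiers ts)) ++
    map (flatten \o rev) (choices (map frontiers ts)).
Proof.
rewrite /frontiers /=; set ch := foldr _ _ _.
have -> : choices (map frontiers ts) = map (map (@frontier C)) ch.
  rewrite {}/ch; elim: ts => //= t ts ->.
  by rewrite allpairs_mapl allpairs_mapr map_allpairs.
rewrite map_cat -!map_comp; congr (_ ++ _); apply: eq_map => us //=.
by rewrite map_rev.
Qed.

Lemma mem_choices us fs :
  (us \in choices fs) = all2 (fun u f => u \in f) us fs.
Proof.
elim: fs us => [|f fs IH] [|u us] //=.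
  by apply/negbTE/allpairsP => -[[x y] [_ _]].
rewrite -IH; apply/allpairsP/andP => [[[x y] [/= xf yc [-> ->]]] //|[uf uc]].
by exists (u, us).
Qed.

Lemma frontiers_perm t s : s \in frontiers t -> perm_eq s (frontier t).
Proof.
elim/tree_nested_ind: t s => [c|ts IH] s; first by rewrite inE => /eqP ->.
have key us : us \in choices (map frontiers ts) ->
    perm_eq (flatten us) (flatten (map (@frontier C) ts)).
  rewrite mem_choices; elim: ts IH us => [|t ts IHts] /= => [_ [|]//|].
  case=> IHt /IHts{}IHts [|u us] //= /andP[/IHt pu /IHts].
  exact: perm_cat.
rewrite frontiers_node mem_cat => /orP[] /mapP[us /key us_p -> //=].
by apply: perm_trans us_p; apply: perm_flatten; rewrite perm_rev.
Qed.

(** Independence of the nodes: choices below a node only permute leaves within one child, and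
    inversions between children do not depend on that. *)
Lemma fwd_bwd_choices ts us :
    all2 (fun u f => u \in f) us (map frontiers ts) ->
  fwd [::] (map (map pos) us) = fwd [::] (map leaves ts) /\
  bwd [::] (map (map pos) us) = bwd [::] (map leaves ts).
Proof.
move=> us_ts; suff p : all2 perm_eq (map (map pos) us) (map leaves ts).
  by split; [exact: perm_fwd | exact: perm_bwd].
elim: ts us us_ts => [|t ts IH] [|u us] //= /andP[/frontiers_perm pu /IH ->].
by rewrite andbT perm_map.
Qed.

(** Inversions split into those inside children, bounded by induction, and those between children,
    equal to [fwd] or [bwd] according to the orientation. *)
Lemma cost_le_invs t s : s \in frontiers t -> cost t <= invs (map pos s).
Proof.
elim/tree_nested_ind: t s => [//|ts IH] s.
have key us : us \in choices (map frontiers ts) ->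
    sumn (map cost ts) <= sumn (map invs (map (map pos) us)).
  rewrite mem_choices; elim: ts IH us => [|t ts IHts] /= => [_ [|]//|].
  case=> IHt /IHts{}IHts [|u us] //= /andP[/IHt pu /IHts].
  exact: leq_add.
rewrite frontiers_node mem_cat => /orP[] /mapP[us us_ch -> /=];
  have := us_ch; rewrite mem_choices => /fwd_bwd_choices[<- <-];
  have := key _ us_ch; rewrite map_flatten ?map_rev.
- by have := invs_flatten [::] (map (map pos) us); rewrite /=; lia.
- by have := invs_flatten_rev [::] (map (map pos) us); rewrite cats0 /=; lia.
Qed.

(** Optimal frontiers of the children are combined in the order that realizes the smaller of [fwd]
    and [bwd]. *)
Lemma cost_eq_invs t : exists2 s, s \in frontiers t & cost t = invs (map pos s).
Proof.
elim/tree_nested_ind: t => [c|ts IH]; first by exists [:: c];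
  rewrite ?inE //= big_nil.
have [us us_ts us_cost] : exists2 us, us \in choices (map frontiers ts) &
    sumn (map cost ts) = sumn (map invs (map (map pos) us)).
  elim: ts IH => [|t ts IHts] /=; first by exists [::];
    rewrite ?inE.
  case=> -[s s_t s_cost] /IHts[us us_ts us_cost]; exists (s :: us) => /=.
    exact: allpairs_f.
  by rewrite s_cost us_cost.
have [F B] : fwd [::] (map (map pos) us) = fwd [::] (map leaves ts) /\
    bwd [::] (map (map pos) us) = bwd [::] (map leaves ts).
  by apply: fwd_bwd_choices; rewrite -mem_choices.
rewrite frontiers_node /= us_cost -F -B.
have [leFB|ltBF] := leqP (fwd [::] (map (map pos) us)) (bwd [::] (map (map pos) us)).
- exists (flatten us); first by rewrite mem_cat map_f.
  by rewrite map_flatten; have := invs_flatten [::] (map (map pos) us); rewrite /=; lia.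
- exists (flatten (rev us)).
    by rewrite mem_cat; apply/orP; right; apply/mapP; exists us.
  rewrite map_flatten map_rev.
  by have := invs_flatten_rev [::] (map (map pos) us); rewrite cats0 /=; lia.
Qed.

Lemma size_leaves t : size (leaves t) = size (frontier t).
Proof. exact: size_map. Qed.

Lemma cost_le t : cost t <= size (leaves t) * size (leaves t).
Proof.
have [s /frontiers_perm/perm_size szs ->] := cost_eq_invs t.
by rewrite size_leaves -szs -(size_map pos) invs_le.
Qed.
End Cost.

(** * Swap distance as an inversion count *)

Section Swap.
Context (C : finType) (v : ranking C).

Definition position (c : C) : nat := index c (ranking_seq v).

Lemma mem_ranking (u : ranking C) c : c \in ranking_seq u.
Proof.
have u_uniq : uniq (ranking_seq u) := valP u.
have u_size : size (enum C) <= size (ranking_seq u) by rewrite -cardE size_tuple.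
have sub : {subset ranking_seq u <= enum C} by move=> x _; rewrite mem_enum.
by have [_ ->] := uniq_min_size u_uniq sub u_size; rewrite mem_enum.
Qed.

Lemma perm_ranking (u : ranking C) : perm_eq (ranking_seq u) (index_enum C).
Proof.
apply: uniq_perm; [exact: (valP u) | exact: index_enum_uniq |].
by move=> c; rewrite mem_ranking mem_index_enum.
Qed.

(** As a sum over pairs of candidates, the count no longer depends on the order of summation, which
    can then run over a fixed enumeration of [C]. *)
Lemma invs_map_uniq (s : seq C) (f : C -> nat) : uniq s ->
  invs (map f s) =
    \sum_(a <- s) \sum_(b <- s) ((index a s < index b s) && (f b < f a)).
Proof.
elim: s => [|x s IH] /=; first by rewrite big_nil.
case/andP=> x_s s_uniq; rewrite IH // big_cons; congr (_ + _).
  rewrite big_cons eqxx /= add0n big_map; apply: eq_big_seq => y y_s.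
  by case: eqP x_s => [-> | _ _] //=; rewrite y_s.
apply: eq_big_seq => a a_s; rewrite big_cons.
have /negPf -> : x != a by apply: contraNneq x_s => ->.
rewrite eqxx ltn0 add0n; apply: eq_big_seq => b b_s.
by have /negPf -> : x != b by apply: contraNneq x_s => ->.
Qed.

Lemma swap_invs (u : ranking C) : swap u v = invs (map position (ranking_seq u)).
Proof.
pose D := [set p : C * C | above u p.1 p.2 && above v p.2 p.1].
have -> : swap u v = #|[set [set p.1; p.2] | p in D]|.
  congr #|pred_of_set _|; apply/setP => e; rewrite inE.
  apply/existsP/imsetP => [[a /existsP[b /and3P[/eqP-> ab ba]]]|[[a b]]].
    by exists (a, b); rewrite ?inE /= ?ab.
  rewrite inE /= => /andP[ab ba] ->; exists a; apply/existsP; exists b.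
  by rewrite eqxx ab.
(* A two-element set determines its ordered pair, since [u] ranks [p.1] above [p.2]: exchanging the
   two would contradict this. *)
rewrite card_in_imset => [|[a b] [c d]]; last first.
  rewrite !inE /above /= => /andP[ab _] /andP[cd _] /setP eq_sets.
  have := eq_sets a; have := eq_sets b; rewrite !inE !eqxx ?orbT.
  move=> /esym/pred2P b_cd /esym/pred2P a_cd.
  by case: a_cd b_cd ab cd => -> [] -> //; lia.
rewrite invs_map_uniq ?(valP u) // (perm_big _ (perm_ranking u)) /=.
under [RHS]eq_bigr do rewrite (perm_big _ (perm_ranking u)) /=.
rewrite pair_bigA /= -sum1_card big_mkcond; apply: eq_bigr => p _.
by rewrite inE /above /position; case: (_ && _).
Qed.

(** Ensures that the default value of the minimum in [swap_set] never undercuts the cost. *)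
Lemma swap_le_bin (u : ranking C) : swap u v <= 'C(#|C|, 2).
Proof.
rewrite -(cardsT C) -cards_draws; apply/subset_leq_card/subsetP => e.
rewrite !inE => /existsP[a /existsP[b /and3P[/eqP-> ab _]]].
have /negPf ab_neq : a != b by apply: contraTneq ab => ->; rewrite /above ltnn.
by rewrite subsetT cards2 ab_neq.
Qed.

Lemma bigminn_le (I : eqType) (r : seq I) (P : pred I) (F : I -> nat) n i :
  i \in r -> P i -> \big[minn/n]_(j <- r | P j) F j <= F i.
Proof.
move=> + Pi; elim: r => // j r IH; rewrite inE big_cons => /orP[/eqP <-|/IH{}IH].
  by rewrite Pi geq_minl.
by case: (P j); rewrite // geq_min IH orbT.
Qed.

Lemma mem_GS (T : tree C) (u : ranking C) :
  (u \in GS T) = (ranking_seq u \in frontiers T).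
Proof.
rewrite inE /frontiers; elim: (reversals T) => //= t ts ->.
by rewrite inE eq_sym.
Qed.

Lemma swap_set_cost (T : tree C) :
  gs_tree T -> swap_set (GS T) v = cost position T.
Proof.
case/and3P=> _ T_uniq /forallP T_all.
have perm_enum : perm_eq (frontier T) (index_enum C).
  apply: uniq_perm => //; first exact: index_enum_uniq.
  by move=> c; rewrite T_all mem_index_enum.
have [s s_T cost_s] := cost_eq_invs position T.
have s_perm := frontiers_perm s_T.
have s_size : size s == #|C|.
  by rewrite (perm_size s_perm) (perm_size perm_enum) cardT enumT.
have s_uniq : uniq (Tuple s_size) by rewrite (perm_uniq s_perm).
pose u : ranking C := exist _ (Tuple s_size) s_uniq.
have swap_u : swap u v = cost position T by rewrite swap_invs cost_s.
apply/eqP; rewrite eqn_leq; apply/andP; split.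
  by rewrite -swap_u; apply: bigminn_le; rewrite ?mem_index_enum ?mem_GS.
rewrite /swap_set; elim/big_ind: _ => [|x y|w].
- by rewrite -swap_u swap_le_bin.
- by rewrite leq_min => -> ->.
- by rewrite mem_GS swap_invs; exact: cost_le_invs.
Qed.
End Swap.

(** * Running programs *)

(* Registers held in a list, so that programs can be executed by simplification. *)
Definition st (l : seq nat) (M : nat -> nat) : state := State (nth 0 l) M.

Definition upd (M : nat -> nat) (a x : nat) : nat -> nat :=
  fun z => if z == a then x else M z.

Section Run.
Context (W : nat).

Definition runs (p : prog) (s : state) (c : nat) (s' : state) : Prop :=
  exists2 t, exec W p s t s' & t <= c.

Lemma runs_le p s c c' s' : c <= c' -> runs p s c s' -> runs p s c' s'.
Proof. by move=> cc' [t ex tc]; exists t => //; exact: leq_trans cc'. Qed.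

Lemma runs_seq p q s c1 s1 c2 s2 :
  runs p s c1 s1 -> runs q s1 c2 s2 -> runs (Seq p q) s (c1 + c2) s2.
Proof.
move=> [t1 ex1 le1] [t2 ex2 le2]; exists (t1 + t2); last exact: leq_add.
exact: exec_seq ex1 ex2.
Qed.

Lemma runs_if_true x y p q s c s' : reg s x < reg s y ->
  runs p s c s' -> runs (If x y p q) s c.+1 s'.
Proof. by move=> ? [t ? ?]; exists t.+1; first exact: exec_if_true. Qed.

Lemma runs_if_false x y p q s c s' : reg s y <= reg s x ->
  runs q s c s' -> runs (If x y p q) s c.+1 s'.
Proof. by move=> ? [t ? ?]; exists t.+1; first exact: exec_if_false. Qed.

Lemma runs_while_true x y p s c1 s1 c2 s2 : reg s x < reg s y ->
  runs p s c1 s1 -> runs (While x y p) s1 c2 s2 ->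
  runs (While x y p) s (c1 + c2).+1 s2.
Proof.
move=> lt_xy [t1 ex1 le1] [t2 ex2 le2]; exists (t1 + t2).+1; last exact: leq_add.
exact: exec_while_true lt_xy ex1 ex2.
Qed.

Lemma runs_while_false x y p s : reg s y <= reg s x ->
  runs (While x y p) s 1 s.
Proof. by exists 1 => //; exact: exec_while_false. Qed.

(* Some iterations of a loop, to be followed by the remaining ones. *)
Definition loops x y p (s : state) (c : nat) (s' : state) : Prop :=
  forall c' s'', runs (While x y p) s' c' s'' ->
    runs (While x y p) s (c + c') s''.

Lemma loops_trans x y p s1 c1 s2 c2 s3 :
  loops x y p s1 c1 s2 -> loops x y p s2 c2 s3 -> loops x y p s1 (c1 + c2) s3.
Proof. by move=> l1 l2 c s /l2/l1; rewrite addnA. Qed.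

Lemma loops1 x y p s c s' : reg s x < reg s y -> runs p s c s' ->
  loops x y p s c.+1 s'.
Proof. by move=> lt_xy run1 c' s'' run2; exact: runs_while_true lt_xy run1 run2. Qed.

(** Weakest precondition of loop-free code, including the absence of overflow. Loops get [False];
    they are handled by induction over their iterations. *)
Fixpoint wp (p : prog) (Q : seq nat -> (nat -> nat) -> Prop) l M : Prop :=
  match p with
  | Skip => Q l M
  | Assign x e =>
      value (st l M) e < W /\ Q (set_nth 0 l x (value (st l M) e)) M
  | Write x y => Q l (upd M (nth 0 l x) (nth 0 l y))
  | Seq p q => wp p (wp q Q) l M
  | If x y p q => if nth 0 l x < nth 0 l y then wp p Q l M else wp q Q l M
  | While _ _ _ => False
  end.

Fixpoint time (p : prog) : nat :=
  match p with
  | Seq p q => time p + time q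
  | If _ _ p q => (maxn (time p) (time q)).+1
  | _ => 1
  end.

Lemma wp_runs_ex p Q l M : wp p Q l M ->
  exists l' M', runs p (st l M) (time p) (st l' M') /\ Q l' M'.
Proof.
elim: p Q l M => [|x e|x y|p IHp q IHq|x y p IHp q IHq|//] Q l M /=.
- by move=> QlM; exists l, M; split=> //; exists 1 => //; exact: exec_skip.
- case=> vW QlM; do 2 eexists; split; last exact: QlM.
  exists 1 => //; have := exec_assign x vW.
  congr (exec _ _ _ _ (State _ _)).
  by apply: functional_extensionality => z; rewrite nth_set_nth.
- move=> QlM; do 2 eexists; split; last exact: QlM.
  by exists 1 => //; exact: exec_write.
- move=> /IHp[l1 [M1 [run1 /IHq[l2 [M2 [run2 Q2]]]]]].
  by exists l2, M2; split=> //; exact: runs_seq run2.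
- case: ltnP => [lt_xy /IHp|le_yx /IHq] [l1 [M1 [run1 Q1]]]; exists l1, M1; split=> //.
    apply: runs_if_true => //; apply: runs_le run1; exact: leq_maxl.
  apply: runs_if_false => //; apply: runs_le run1; exact: leq_maxr.
Qed.

Lemma wp_runs p l M l' M' : wp p (fun l1 M1 => l1 = l' /\ M1 = M') l M ->
  runs p (st l M) (time p) (st l' M').
Proof. by case/wp_runs_ex=> l1 [M1 [run [<- <-]]]. Qed.

End Run.

Definition seg (M : nat -> nat) (b : nat) (l : seq nat) : Prop :=
  forall i, i < size l -> M (b + i) = nth 0 l i.

Lemma seg_cons M b x l : seg M b (x :: l) <-> M b = x /\ seg M b.+1 l.
Proof.
split=> [s|[Mb s] [|i] lt_i].
- split=> [|i lt_i]; first by rewrite -(addn0 b) s.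
  by rewrite addSnnS s.
- by rewrite addn0.
- by rewrite -addSnnS s.
Qed.

Lemma seg_cat M b l1 l2 : seg M b (l1 ++ l2) <-> seg M b l1 /\ seg M (b + size l1) l2.
Proof.
elim: l1 b => [|x l1 IH] b; first by rewrite addn0; split=> [|[]].
by rewrite cat_cons !seg_cons IH /= addSnnS; tauto.
Qed.

Lemma eq_seg M M' b l : (forall z, b <= z < b + size l -> M' z = M z) ->
  seg M b l -> seg M' b l.
Proof. by move=> eqM s i lt_i; rewrite eqM ?s //; lia. Qed.

(** * The program *)

Local Notation "p ;; q" := (Seq p q) (at level 65, right associativity).
Local Notation rAns := 0 (only parsing).
Local Notation rOne := 1 (only parsing).
Local Notation rZero := 2 (only parsing).
Local Notation rTwo := 3 (only parsing).
Local Notation rM := 4 (only parsing).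
Local Notation rP := 5 (only parsing).
Local Notation rN := 6 (only parsing).
Local Notation rSP := 7 (only parsing).
Local Notation rMode := 8 (only parsing).
Local Notation rPos := 9 (only parsing).
Local Notation rBase := 10 (only parsing).
Local Notation rX := 11 (only parsing).
Local Notation rR := 12 (only parsing).
Local Notation rFst := 13 (only parsing).
Local Notation rMid := 14 (only parsing).
Local Notation rA := 15 (only parsing).
Local Notation rB := 16 (only parsing).
Local Notation rI := 17 (only parsing).
Local Notation rJ := 18 (only parsing).
Local Notation rFI := 19 (only parsing).
Local Notation rFJ := 20 (only parsing).

(* The cells [rFst, rMid) hold the positions in v of the leaves of the earlier
   children of the open node, [rMid, rN) those of the child just completed, and
   rR counts the children still missing. In rMode 0 a code starts at rP, in
   rMode 1 a subtree has just been completed, in rMode 2 the tree has. *)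
Definition push x := Write rSP x ;; Assign rSP (Add rSP rOne).
Definition pop x := Assign rSP (Defs.Sub rSP rOne) ;; Assign x (Read rSP).
Definition incr x := Assign x (Add x rOne).
Definition copy x y := Assign x (Add y rZero).

(** [rA] counts pairs inverted in the given order of the children, [rB] those inverted in the
    reverse order. *)
Definition inner_body :=
  Assign rFJ (Read rJ) ;; If rFJ rFI (incr rA) Skip ;;
  If rFI rFJ (incr rB) Skip ;; incr rJ.

Definition inner := While rJ rN inner_body.

Definition outer := While rI rMid
  ((Assign rFI (Read rI) ;; copy rJ rMid) ;; inner ;; incr rI).

Definition push_frame := push rR ;; push rFst ;; push rN ;; push rA ;; push rB.

(** The slot filled from [rN] is popped into [rMid]: the end of the leaves known when the frame was
    pushed separates the earlier children from the one just completed. *)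
Definition pop_frame := pop rB ;; pop rA ;; pop rMid ;; pop rFst ;; pop rR.

(** After the last child no frame is pushed and [rMode] stays 1, so the node itself counts as the
    completed child of its parent. *)
Definition close_child :=
  Assign rR (Defs.Sub rR rOne) ;;
  If rZero rR (push_frame ;; Assign rMode (Const 0))
    (If rA rB (Assign rAns (Add rAns rA)) (Assign rAns (Add rAns rB))).

Definition return_step :=
  If rBase rSP
    (((pop_frame ;; copy rI rFst) ;; outer) ;; close_child)
    (Assign rMode (Const 2)).

Definition read_step :=
  Assign rX (Read rP) ;; incr rP ;;
  If rZero rX
    (copy rR rX ;; copy rFst rN ;; copy rA rZero ;; copy rB rZero ;; push_frame)
    (Assign rX (Read rP) ;; incr rP ;; Assign rX (Add rX rPos) ;;
     Assign rX (Read rX) ;; Write rN rX ;; incr rN ;; Assign rMode (Const 1)).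

Definition step := If rZero rMode return_step read_step.

Definition regs (m pos base ans P N SP mode : nat) (tm : seq nat) : seq nat :=
  [:: ans, 1, 0, 2, m, P, N, SP, mode, pos, base & tm].

(** * Execution of the comparison loops *)

Section Loops.
Context (W m pos base ans P N SP mode : nat) (M : nat -> nat).

Local Notation S tm := (st (regs m pos base ans P N SP mode tm) M).

Lemma inner_run l x r a b A B i j fi fj :
  seg M j l -> j + size l = N -> N < W -> all (gtn W) l ->
  A + \sum_(y <- l) (y < fi) < W -> B + \sum_(y <- l) (fi < y) < W ->
  exists fj', runs W inner (S [:: x; r; a; b; A; B; i; j; fi; fj]) (7 * size l + 1)
    (S [:: x; r; a; b; A + \sum_(y <- l) (y < fi); B + \sum_(y <- l) (fi < y);
           i; N; fi; fj']).
Proof.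
elim: l A B j fj => [|y l IH] A B j fj /=.
  rewrite !big_nil !addn0 => _ jN _ _ _ _; exists fj; rewrite jN.
  by apply: runs_while_false => /=.
rewrite !big_cons !addnA => /seg_cons[Mj seg_l] jN NW /andP[yW lW] AW BW.
have [|||fj' run] := IH (A + (y < fi)) (B + (fi < y)) j.+1 y seg_l _ NW lW; try lia.
exists fj'; apply: runs_le (runs_while_true _ _ run) => /=; last first.
- apply: wp_runs; rewrite /= Mj !addn1; split=> //.
  move: AW BW; case: (ltnP y fi) => _; case: (ltnP fi y) => _ AW BW /=;
    do ?split; rewrite ?addn0 ?addn1 //; lia.
- lia.
(* Six steps for the body and one for the test. *)
- have -> : time inner_body = 6 by []; lia.
Qed.

Lemma outer_run l1 l2 x r a b A B i j fi fj :
  seg M i l1 -> i + size l1 = b -> seg M b l2 -> b + size l2 = N -> N < W ->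
  all (gtn W) l1 -> all (gtn W) l2 ->
  A + cross l1 l2 < W -> B + cross l2 l1 < W ->
  exists j' fi' fj', runs W outer (S [:: x; r; a; b; A; B; i; j; fi; fj])
    (size l1 * (7 * size l2 + 5) + 1)
    (S [:: x; r; a; b; A + cross l1 l2; B + cross l2 l1; b; j'; fi'; fj']).
Proof.
(* Both counts become sums with [l1] outside, matching the nesting of the loops. *)
have -> : cross l2 l1 = \sum_(x <- l1) \sum_(y <- l2) (x < y).
  by rewrite /cross exchange_big.
elim: l1 A B i j fi fj => [|z l1 IH] A B i j fi fj /=.
  rewrite /cross !big_nil !addn0 => _ ib *; exists j, fi, fj; rewrite ib.
  by apply: runs_while_false => /=.
rewrite cross_cons !big_cons !addnA.
move=> /seg_cons[Mi seg_l1] ib seg_l2 bN NW /andP[zW l1W] l2W AW BW.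
have [||fj1 run1] := @inner_run l2 x r a b A B i b z fj seg_l2 bN NW l2W; try lia.
have [|j' [fi' [fj' run]]] := IH _ _ i.+1 N z fj1 seg_l1 _ seg_l2 bN NW l1W l2W AW BW.
  lia.
exists j', fi', fj'.
apply: runs_le (runs_while_true _ (runs_seq _ (runs_seq run1 _)) run) => /=; last first.
- by apply: wp_runs; rewrite /= addn1; split=> //; lia.
- by apply: wp_runs; rewrite /= Mi addn0; do ?split => //; lia.
- lia.
- rewrite /=; nia.
Qed.
End Loops.

(** * Correctness and running time *)

(** Addresses are spelled as iterated increments because executing the pushes produces this form. *)
Definition frame (M : nat -> nat) (SP r a b A B : nat) : Prop :=
  [/\ M SP = r, M (SP + 1) = a, M (SP + 1 + 1) = b, M (SP + 1 + 1 + 1) = A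
    & M (SP + 1 + 1 + 1 + 1) = B].

Lemma eq_frame M M' SP r a b A B :
  (forall z, SP <= z < SP + 5 -> M' z = M z) ->
  frame M SP r a b A B -> frame M' SP r a b A B.
Proof. by move=> eqM [? ? ? ? ?]; split; rewrite eqM //; lia. Qed.

Definition frame_upd M SP r a b A B : nat -> nat :=
  upd (upd (upd (upd (upd M SP r) (SP + 1) a) (SP + 1 + 1) b)
    (SP + 1 + 1 + 1) A) (SP + 1 + 1 + 1 + 1) B.

Lemma frame_updP M SP r a b A B : frame (frame_upd M SP r a b A B) SP r a b A B.
Proof. by split; rewrite /frame_upd /upd; do !case: eqP => //; lia. Qed.

Lemma frame_upd_below M SP r a b A B z : z < SP ->
  frame_upd M SP r a b A B z = M z.
Proof. by move=> zSP; rewrite /frame_upd /upd; do !case: eqP => //; lia. Qed.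

(** * Closing a child of a node *)

Section CloseChild.
Context (W m Qb Sb ans P N SP : nat) (tm : seq nat) (M : nat -> nat).
Context (r a b A B : nat) (L l : seq nat).
Context (size_tm : size tm = 10) (SbSP : Sb <= SP) (SPW : SP + 5 < W).
Context (frameM : frame M SP r a b A B).
Context (seg_L : seg M a L) (aL : a + size L = b).
Context (seg_l : seg M b l) (bl : b + size l = N).
Context (LW : all (gtn W) L) (lW : all (gtn W) l) (NW : N < W) (rW : r < W).
Context (AW : A + cross L l < W) (BW : B + cross l L < W).

Let top := SP + 1 + 1 + 1 + 1 + 1.

Lemma pop_outer_run : exists x j fi fj,
  runs W ((pop_frame ;; copy rI rFst) ;; outer)
    (st (regs m Qb Sb ans P N top 1 tm) M) (11 + (size L * (7 * size l + 5) + 1))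
    (st (regs m Qb Sb ans P N SP 1
      [:: x; r; a; b; A + cross L l; B + cross l L; b; j; fi; fj]) M).
Proof.
case: tm size_tm => [|x [|r0 [|a0 [|b0 [|A0 [|B0 [|i0 [|j0 [|fi0 [|fj0 [|]]]]]]]]]]] // _.
have [j [fi [fj run]]] := @outer_run W m Qb Sb ans P N SP 1 M L l x r a b A B a j0 fi0 fj0
  seg_L aL seg_l bl NW LW lW AW BW.
exists x, j, fi, fj; apply: runs_seq run; apply: wp_runs.
have [Mr Ma Mb MA MB] := frameM.
rewrite /top /= !addnK Mr Ma Mb MA MB !addn0; do ?split; lia.
Qed.

Lemma close_last_run : r = 1 -> ans + minn (A + cross L l) (B + cross l L) < W ->
  exists2 tm', size tm' = 10 & runs W step
    (st (regs m Qb Sb ans P N top 1 tm) M) (size L * (7 * size l + 5) + 30)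
    (st (regs m Qb Sb (ans + minn (A + cross L l) (B + cross l L)) P N SP 1 tm') M).
Proof.
move=> r1 ansW; have [x [j [fi [fj run]]]] := pop_outer_run.
exists [:: x; 0; a; b; A + cross L l; B + cross l L; b; j; fi; fj] => //.
have run' : runs W close_child (st (regs m Qb Sb ans P N SP 1
      [:: x; r; a; b; A + cross L l; B + cross l L; b; j; fi; fj]) M) 13
    (st (regs m Qb Sb (ans + minn (A + cross L l) (B + cross l L)) P N SP 1
      [:: x; 0; a; b; A + cross L l; B + cross l L; b; j; fi; fj]) M).
  apply: wp_runs; rewrite /= r1 /=; split; first lia.
  by move: ansW; rewrite /minn; case: ifP.
apply: runs_le (runs_if_true _ _ (runs_if_true _ _ (runs_seq run run'))) => //=;
  rewrite /top; lia.
Qed.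

Lemma close_next_run : 1 < r ->
  exists2 tm', size tm' = 10 & runs W step
    (st (regs m Qb Sb ans P N top 1 tm) M) (size L * (7 * size l + 5) + 30)
    (st (regs m Qb Sb ans P N top 0 tm')
      (frame_upd M SP r.-1 a N (A + cross L l) (B + cross l L))).
Proof.
move=> r1; have [x [j [fi [fj run]]]] := pop_outer_run.
exists [:: x; r.-1; a; b; A + cross L l; B + cross l L; b; j; fi; fj] => //.
have run' : runs W close_child (st (regs m Qb Sb ans P N SP 1
      [:: x; r; a; b; A + cross L l; B + cross l L; b; j; fi; fj]) M) 13
    (st (regs m Qb Sb ans P N top 0
      [:: x; r.-1; a; b; A + cross L l; B + cross l L; b; j; fi; fj])
      (frame_upd M SP r.-1 a N (A + cross L l) (B + cross l L))).
  apply: wp_runs; rewrite /= subn1 ifT; last lia.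
  by rewrite /top; do ?split; lia.
apply: runs_le (runs_if_true _ _ (runs_if_true _ _ (runs_seq run run'))) => //=;
  rewrite /top; lia.
Qed.
End CloseChild.

(** * Size bounds and amortized cost *)

Lemma size_tree_code (C : finType) (t : tree C) : branching t ->
  0 < size (frontier t) /\ size (tree_code t) < 3 * size (frontier t).
Proof.
elim/tree_nested_ind: t => [//|ts IH] /= /andP[ts_gt1 ts_br].
(* Each child leaves at least one cell of its allowance of 3 per leaf unspent; with two or more
   children this pays for the node's own cell. *)
suff : size ts <= size (flatten (map (@frontier C) ts)) /\
    size (flatten (map (@tree_code C) ts)) + size ts <=
    3 * size (flatten (map (@frontier C) ts)) by case=> ? ?; split; lia.
elim: ts IH ts_br {ts_gt1} => //= t ts IHts [IHt /IHts{}IHts] /andP[/IHt{}IHt /IHts].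
rewrite !size_cat; lia.
Qed.

Lemma size_children_le (C : finType) (pos : C -> nat) ts :
  all (@branching C) ts -> size ts <= size (flatten (map (leaves pos) ts)).
Proof.
elim: ts => //= t ts IH /andP[t_br /IH]; rewrite size_cat size_leaves.
have [] := size_tree_code t_br; lia.
Qed.

(** Every sibling has a leaf. With two or more children, a child therefore has fewer leaves than its
    node, which leaves room for one frame of five cells. *)
Lemma size_child_lt (C : finType) (pos : C -> nat) ts :
  all (@branching C) ts ->
  all (fun t => size (leaves pos t) + size ts <=
    size (flatten (map (leaves pos) ts)) + 1) ts.
Proof.
elim: ts => //= t ts IH /andP[t_br ts_br]; rewrite size_cat; apply/andP; split.
  have := size_children_le pos ts_br; lia.
apply: sub_all (IH ts_br) => u; have [] := size_tree_code t_br.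
rewrite -(size_leaves pos); lia.
Qed.

Definition rank (C : finType) (c : C) : nat := enum_rank c.

(** For [a > 0] the cross term [160 * a * n] of the square, with the slack 40, pays for the
    comparisons and the reserve of 80; for [a = 0] the slack covers the 31 steps. *)
Lemma last_child_cost c a n : 0 < n -> c + 40 <= 80 * (n * n) ->
  c + (a * (7 * n + 5) + 30).+1 + 80 * (a * a) + (if 0 < a then 80 else 0) <=
    80 * ((a + n) * (a + n)).
Proof. case: ifP; nia. Qed.

(** The reserve of 80 is passed on from the remaining children, which follow at least one leaf. *)
Lemma next_child_cost c c' a n k : 0 < n -> c + 40 <= 80 * (n * n) ->
  c' + 80 * ((a + n) * (a + n)) + 80 <= 80 * ((a + n + k) * (a + n + k)) ->
  c + (a * (7 * n + 5) + 30).+1 + c' + 80 * (a * a) + 80 <=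
    80 * ((a + (n + k)) * (a + (n + k))).
Proof.
move=> n_gt0 c_le; rewrite addnA; move: (_ * (a + n + k)) => s c'_le; nia.
Qed.

(** * Running the machine on a subtree *)

Section Machine.
Context (C : finType) (pos : C -> nat) (W m Qb Sb Top : nat).
Context (TopW : Top < W) (W_gt2 : 2 < W).
Context (Sb_le : Sb <= Qb + m + m) (mmW : m * m < W).
Context (pos_lt : forall c, pos c < W) (rank_m : forall c : C, rank c < m).

Local Notation lv := (leaves pos).
Local Notation S ans P N SP mode tm M := (st (regs m Qb Sb ans P N SP mode tm) M).

Definition valid (M : nat -> nat) P N SP (code : seq nat) : Prop :=
  [/\ seg M P code, P + size code <= N, Qb + m <= N, Sb <= SP
    & forall c, M (Qb + rank c) = pos c].

(** Protects the code, the position table, the leaves gathered so far and the open frames. *)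
Definition preserved (M M' : nat -> nat) N SP : Prop :=
  forall z, (z < N) || (Sb <= z < SP) -> M' z = M z.

(* The slack 40 pays for the overhead of closing t in its parent; comparing n
   leaves with a > 0 earlier ones is paid by (a + n)^2 - a^2 - n^2. *)
Definition tree_run (t : tree C) : Prop := forall M ans P N SP tm,
  branching t -> size tm = 10 -> valid M P N SP (tree_code t) ->
  N + size (lv t) <= Sb -> SP + 5 * size (lv t) <= Top -> ans + cost pos t < W ->
  exists c M' tm', [/\ size tm' = 10, preserved M M' N SP, seg M' N (lv t),
    c + 40 <= 80 * (size (lv t) * size (lv t)) &
    loops W rMode rTwo step (S ans P N SP 0 tm M) c
      (S (ans + cost pos t) (P + size (tree_code t)) (N + size (lv t)) SP 1 tm' M')].

Lemma leaf_run c : tree_run (Leaf c).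
Proof.
move=> M ans P N SP tm _ size_tm.
case=> /seg_cons[MP /seg_cons[MP1 _]] /= PN QN SbSP Mpos NSb SPT ansW.
have rank_c := rank_m c; have {}MP1 : M P.+1 = rank c := MP1.
have pos_c := pos_lt c.
case: tm size_tm => [|x [|r0 [|a0 [|b0 [|A0 [|B0 [|i0 [|j0 [|fi0 [|fj0 [|]]]]]]]]]]] // _.
exists 20, (upd M N (pos c)), [:: pos c; r0; a0; b0; A0; B0; i0; j0; fi0; fj0].
split=> //.
- by move=> z; rewrite /upd; case: eqP => // ->; lia.
- by apply/seg_cons; rewrite /upd eqxx.
apply: loops1 => //; apply: runs_le (runs_if_false _ _ (wp_runs _)) => //=.
rewrite MP /= !addn1 MP1 (addnC _ Qb) Mpos addn0 addn2; do ?split => //; lia.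
Qed.

(** Induction over the children still to be read, with [L] the leaves of the earlier ones. The
    reserve of 80 is missing only when a first child is also the last, which cannot happen for a
    whole branching node. *)
Lemma forest_run ts : foldr (fun t => and (tree_run t)) True ts ->
  forall M ans P N SP tm L a A B,
  0 < size ts -> all (@branching C) ts -> size tm = 10 ->
  valid M P N SP (flatten (map (@tree_code C) ts)) ->
  N + size (flatten (map lv ts)) <= Sb ->
  all (fun t => SP + 5 + 5 * size (lv t) <= Top) ts ->
  frame M SP (size ts) a N A B -> seg M a L -> a + size L = N ->
  all (gtn W) L ->
  A + fwd L (map lv ts) < W -> B + bwd L (map lv ts) < W ->
  ans + sumn (map (cost pos) ts) +
    minn (A + fwd L (map lv ts)) (B + bwd L (map lv ts)) < W ->
  exists c M' tm', [/\ size tm' = 10, preserved M M' N SP,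
    seg M' N (flatten (map lv ts)),
    c + 80 * (size L * size L) + (if (0 < size L) || (1 < size ts) then 80 else 0) <=
      80 * ((size L + size (flatten (map lv ts))) * (size L + size (flatten (map lv ts)))) &
    loops W rMode rTwo step (S ans P N (SP + 1 + 1 + 1 + 1 + 1) 0 tm M) c
      (S (ans + sumn (map (cost pos) ts) +
           minn (A + fwd L (map lv ts)) (B + bwd L (map lv ts)))
         (P + size (flatten (map (@tree_code C) ts)))
         (N + size (flatten (map lv ts))) SP 1 tm' M')].
Proof.
elim: ts => [//|t ts IH] /= [t_run ts_run] M ans P N SP tm L a A B _ /andP[t_br ts_br] size_tm.
case=> /seg_cat[seg_t seg_ts]; rewrite !size_cat => PN QN SbSP Mpos NSb.
move=> /andP[t_Top ts_Top] frameM seg_L aL LW AW BW ansW.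
have [t_gt0 _] := size_tree_code t_br; rewrite -(size_leaves pos) in t_gt0.
have lW : all (gtn W) (lv t) by apply/allP => z /mapP[c _ ->]; exact: pos_lt.
have [||||c1 [M1 [tm1 [size_tm1 pres1 seg1 c1_le loop1]]]] :=
  t_run M ans P N (SP + 1 + 1 + 1 + 1 + 1) tm t_br size_tm.
- by split=> //; lia.
- lia.
- lia.
- lia.
have frame1 : frame M1 SP (size ts).+1 a N A B.
  by apply: eq_frame frameM => z ?; apply: pres1; lia.
have seg_L1 : seg M1 a L by apply: eq_seg seg_L => z ?; apply: pres1; lia.
have sizes_le := size_children_le pos ts_br.
have SPW : SP + 5 < W by lia.
have NW : N + size (lv t) < W by lia.
have rW : (size ts).+1 < W by lia.
have AW1 : A + cross L (lv t) < W by lia.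
have BW1 : B + cross (lv t) L < W by lia.
have [/size0nil ts0|ts_gt0] := posnP (size ts).
  move: ansW frame1; rewrite {}ts0 /= !addn0 => ansW frame1.
  have [|tm2 size_tm2 run2] := close_last_run m Qb
    (P + size (tree_code t)) size_tm1 SbSP SPW frame1 seg_L1 aL
    seg1 erefl LW lW NW _ AW1 BW1 erefl ansW.
    lia.
  exists (c1 + (size L * (7 * size (lv t) + 5) + 30).+1), M1, tm2.
  rewrite cats0 orbF; split=> //.
  - by move=> z ?; apply: pres1; lia.
  - exact: last_child_cost.
  - by apply: loops_trans loop1 _; apply: loops1.
have [|tm2 size_tm2 run2] := close_next_run m Qb (ans + cost pos t)
  (P + size (tree_code t)) size_tm1 SbSP SPW frame1 seg_L1 aL
  seg1 erefl LW lW NW rW AW1 BW1.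
  by [].
move: run2; rewrite [_.+1.-1]/=; set M2 := frame_upd _ _ _ _ _ _ _ => run2.
have pres2 z : (z < N + size (lv t)) || (Sb <= z < SP) -> M2 z = M1 z.
  by move=> ?; apply: frame_upd_below; lia.
(* The leaves of [t] directly follow [L] in memory, so the recursion continues with the contiguous
   list [L ++ lv t]. *)
have [||||||||||c3 [M3 [tm3 [size_tm3 pres3 seg3 c3_le loop3]]]] :=
  IH ts_run M2 (ans + cost pos t) (P + size (tree_code t)) (N + size (lv t)) SP tm2
    (L ++ lv t) a (A + cross L (lv t)) (B + cross (lv t) L) ts_gt0 ts_br size_tm2.
- split=> //; try lia.
    by apply: eq_seg seg_ts => z ?; rewrite pres2 ?pres1 //; lia.
  by move=> c; rewrite pres2 ?pres1 ?Mpos //; have := rank_m c; lia.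
- lia.
- exact: ts_Top.
- exact: frame_updP.
- apply/seg_cat; rewrite aL; split.
    by apply: eq_seg seg_L1 => z ?; apply: pres2; lia.
  by apply: eq_seg seg1 => z ?; apply: pres2; lia.
- by rewrite size_cat addnA aL.
- by rewrite all_cat LW.
- lia.
- lia.
- lia.
rewrite size_cat addn_gt0 t_gt0 orbT in c3_le.
exists (c1 + (size L * (7 * size (lv t) + 5) + 30).+1 + c3), M3, tm3; split=> //.
- by move=> z ?; rewrite pres3 ?pres2 ?pres1 //; lia.
- apply/seg_cat; split=> //.
  by apply: eq_seg seg1 => z ?; rewrite pres3 ?pres2 //; lia.
- by rewrite ltnS ts_gt0 orbT; exact: next_child_cost.
- rewrite !addnA in loop3 *.
  exact: loops_trans (loops_trans loop1 (loops1 _ run2)) loop3.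
Qed.

Lemma node_run ts : foldr (fun t => and (tree_run t)) True ts -> tree_run (Node ts).
Proof.
move=> ts_run M ans P N SP tm br size_tm [/seg_cons[MP seg_ts] PN QN SbSP Mpos] NSb SPT ansW.
have [ts_gt1 ts_br] : 1 < size ts /\ all (@branching C) ts by apply/andP.
rewrite [size (tree_code _)]/= in PN.
have {}seg_ts : seg M P.+1 (flatten (map (@tree_code C) ts)) by [].
have lvE : lv (Node ts) = flatten (map lv ts) by rewrite /leaves /= map_flatten -map_comp.
have ts_le := size_children_le pos ts_br.
have child_lt := size_child_lt pos ts_br.
have FB_le := fwd_bwd_le [::] (map lv ts).
rewrite /= addn0 !add0n in FB_le.
rewrite lvE in NSb SPT *.
set F := size (flatten (map lv ts)) in NSb SPT ts_le FB_le child_lt *.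
(* [F <= m], because the leaves lie between the end of the position table and the stack base; all
   counts then fit in a word. *)
have FFW : F * F < W by nia.
case: tm size_tm => [|x [|r0 [|a0 [|b0 [|A0 [|B0 [|i0 [|j0 [|fi0 [|fj0 [|]]]]]]]]]]] // _.
pose tm1 := [:: size ts; size ts; N; b0; 0; 0; i0; j0; fi0; fj0].
(* The segment of earlier leaves is empty at first: it starts and ends at [N]. *)
pose M1 := frame_upd M SP (size ts) N N 0 0.
have run1 : runs W step (S ans P N SP 0 [:: x; r0; a0; b0; A0; B0; i0; j0; fi0; fj0] M) 18
    (S ans P.+1 N (SP + 1 + 1 + 1 + 1 + 1) 0 tm1 M1).
  apply: runs_le (runs_if_false _ _ (wp_runs _)) => //=.
  rewrite MP /= ifT; last lia.
  rewrite /M1 /frame_upd !addn0 !addn1; do ?split; lia.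
have M1_M z : z < SP -> M1 z = M z by exact: frame_upd_below.
have [||||||||||c3 [M3 [tm3 [size_tm3 pres3 seg3 c3_le loop3]]]] :=
  @forest_run ts ts_run M1 ans P.+1 N SP tm1 [::] N 0 0 (ltnW ts_gt1) ts_br erefl.
- split=> //; try lia.
    by apply: eq_seg seg_ts => z ?; rewrite M1_M //; lia.
  by move=> c; rewrite M1_M ?Mpos //; have := rank_m c; lia.
- by [].
- by apply: sub_all child_lt => u; lia.
- exact: frame_updP.
- by [].
- by rewrite addn0.
- by [].
- lia.
- lia.
- by rewrite /= addnA in ansW; rewrite !add0n.
rewrite /= muln0 !addn0 !add0n ts_gt1 in c3_le.
(* Opening the node takes at most 19 steps; with the slack 40 this stays within the reserve of
   80. *)
exists (19 + c3), M3, tm3; split=> //.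
- by move=> z ?; rewrite pres3 ?M1_M //; lia.
- by rewrite -/F in c3_le *; lia.
- rewrite [size (tree_code _)]/= addnS -addSn [cost _ _]/= addnA.
  by rewrite !add0n in loop3; apply: loops_trans (loops1 _ run1) loop3.
Qed.

Lemma tree_run_all t : tree_run t.
Proof.
elim/tree_nested_ind: t => [c|ts]; [exact: leaf_run | exact: node_run].
Qed.
End Machine.

(** * Setup and the complete run *)

(* The input occupies fewer than 5m cells; the positions in v are stored from
   5m on, the leaves from 6m on, and the stack from 7m on. *)
Definition setup :=
  Assign rOne (Const 1) ;; Assign rTwo (Const 2) ;; Assign rM (Read rZero) ;;
  Assign rP (Add rM rOne) ;;
  Assign rX (Add rM rM) ;; Assign rX (Add rX rX) ;; Assign rPos (Add rX rM) ;;
  Assign rN (Add rPos rM) ;; Assign rBase (Add rN rM) ;; copy rSP rBase.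

(** Cell 0 holds [m], so the name at position i is in cell i + 1; after its use as an address, [rJ]
    serves as the next position. *)
Definition positions_body :=
  Assign rJ (Add rI rOne) ;; Assign rX (Read rJ) ;; Assign rX (Add rX rPos) ;;
  Write rX rI ;; copy rI rJ.

Definition positions := While rI rM positions_body.

Definition gs_swap := (setup ;; positions) ;; While rMode rTwo step.

(** Names are distinct, so no entry is overwritten later; [m < Qb] keeps the writes off the names
    still to be read. *)
Lemma positions_run W m Qb Sb P N SP (s1 s2 : seq nat) M x r a b A B j fi fj :
  uniq (s1 ++ s2) -> size (s1 ++ s2) = m -> all (gtn m) (s1 ++ s2) ->
  m < Qb -> Qb + m < W ->
  seg M 1 (s1 ++ s2) ->
  (forall c : nat, c \in s1 -> M (Qb + c) = index c (s1 ++ s2)) ->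
  exists M' x' j', [/\ forall z, z < Qb -> M' z = M z,
    forall c : nat, c \in s1 ++ s2 -> M' (Qb + c) = index c (s1 ++ s2) &
    runs W positions
      (st (regs m Qb Sb 0 P N SP 0 [:: x; r; a; b; A; B; size s1; j; fi; fj]) M)
      (6 * size s2 + 1)
      (st (regs m Qb Sb 0 P N SP 0 [:: x'; r; a; b; A; B; m; j'; fi; fj]) M')].
Proof.
elim: s2 s1 M x j => [|y s2 IH] s1 M x j names_uniq names_size names_lt mQ QW seg_names Mpos.
  exists M, x, j; split=> //; first by move=> c; rewrite {1}cats0; exact: Mpos.
  rewrite -names_size cats0; exact: runs_while_false.
have idx_y : index y (s1 ++ y :: s2) = size s1.
  rewrite index_cat /= eqxx addn0; case: ifP => // y_s1; move: names_uniq.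
  by rewrite cat_uniq /= y_s1 orTb andbF.
have y_lt : y < m by apply: (allP names_lt); rewrite mem_cat mem_head orbT.
have sz : size s1 + (size s2).+1 = m by rewrite -names_size size_cat.
have [_ /seg_cons[My _]] := (seg_cat M 1 s1 (y :: s2)).1 seg_names.
pose M1 := upd M (y + Qb) (size s1).
have [|||||||M' [x' [j' [below pos' run]]]] := IH (rcons s1 y) M1 (y + Qb) (size s1 + 1);
  rewrite ?cat_rcons //.
- by apply: eq_seg seg_names => z ?; rewrite /M1 /upd; case: eqP => //; lia.
- move=> c; rewrite mem_rcons inE => c_s1; rewrite /M1 /upd.
  case: eqP => [?|neq]; first by have -> : c = y by lia.
  by apply: Mpos; case/orP: c_s1 => // /eqP c_y; case: neq; rewrite c_y addnC.
rewrite cat_rcons in pos'; exists M', x', j'; split=> //.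
  by move=> z ?; rewrite below // /M1 /upd; case: eqP => //; lia.
rewrite size_rcons in run.
apply: runs_le (runs_while_true _ _ run) => /=; last first.
- apply: wp_runs; rewrite /= [size s1 + 1]addnC My addn0 add1n /M1; do ?split => //; lia.
- rewrite /=; lia.
- rewrite /=; lia.
Qed.

Lemma rank_inj (C : finType) : injective (@rank C).
Proof. by move=> x y /val_inj/enum_rank_inj. Qed.

Lemma setup_run W m M : M 0 = m -> 2 < W -> 7 * m < W -> runs W setup (State (fun=> 0) M) 10
  (st (regs m (5 * m) (7 * m) 0 m.+1 (6 * m) (7 * m) 0
    [:: 4 * m; 0; 0; 0; 0; 0; 0; 0; 0; 0]) M).
Proof.
move=> M0 W2 mW.
have -> : State (fun=> 0) M = st (nseq 21 0) M.
  by congr State; apply: functional_extensionality => z; rewrite nth_nseq if_same.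
apply: wp_runs; rewrite /= M0 /regs; do !split; try lia.
do !congr (_ :: _); lia.
Qed.

Lemma gs_swap_run (C : finType) (T : tree C) (v : ranking C) : gs_tree T ->
  exists s, runs (20 * #|C| ^ 20) gs_swap (init T v) (200 * #|C| ^ 2) s /\
    output s = swap_set (GS T) v.
Proof.
move=> T_gs; have /and3P[T_br T_uniq /forallP T_all] := T_gs.
set m := #|C|; set W := 20 * _.
have T_size : size (frontier T) = m.
  rewrite /m cardE; apply: perm_size; apply: uniq_perm; rewrite ?enum_uniq // => c.
  by rewrite T_all mem_enum.
have [m_gt0 code_lt] := size_tree_code T_br; rewrite T_size in m_gt0 code_lt.
have mmW : 20 * (m * m) <= W.
  by rewrite /W leq_mul2l mulnn leq_pexp2l.
have names_lt (c : C) : rank c < m by exact: (ltn_ord (enum_rank c)).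
pose names := map (@rank C) (ranking_seq v).
have names_size : size names = m by rewrite size_map size_tuple.
have names_uniq : uniq names by rewrite (map_inj_uniq (@rank_inj C)) (valP v).
pose M0 := nth 0 (input T v).
have seg0 : seg M0 0 (input T v) by [].
have [M0m /seg_cat[seg_names seg_code]] := (seg_cons M0 0 m (names ++ tree_code T)).1 seg0.
rewrite names_size add1n in seg_code.
have W2 : 2 < W by nia.
(* Addresses stay within [12 * m]: the stack starts at [7 * m] and takes at most five cells per
   leaf. *)
have mW : 12 * m < W by nia.
have mW7 : 7 * m < W by lia.
have run1 := setup_run M0m W2 mW7.
have [|||||M1 [x1 [j1 [below pos1 run2]]]] := @positions_run W m (5 * m) (7 * m) m.+1 (6 * m)
  (7 * m) [::] names M0 (4 * m) 0 0 0 0 0 0 0 0 names_uniq names_size.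
- by apply/allP => _ /mapP[c _ ->]; exact: names_lt.
- lia.
- lia.
- exact: seg_names.
- by [].
have pos_lt c : position v c < m.
  have -> : m = size (ranking_seq v) by rewrite size_tuple.
  by rewrite /position index_mem mem_ranking.
have T_leaves : size (leaves (position v) T) = m by rewrite size_leaves.
have T_cost := cost_le (position v) T; rewrite T_leaves in T_cost.
have [|||||||c [M2 [tm2 [size_tm2 _ _ c_le loop]]]] :=
  @tree_run_all C (position v) W m (5 * m) (7 * m) (12 * m) mW W2 _ _ _ names_lt
  T M1 0 m.+1 (6 * m) (7 * m) [:: x1; 0; 0; 0; 0; 0; m; j1; 0; 0] T_br erefl.
- lia.
- lia.
- by move=> c; have := pos_lt c; lia.
- split; try lia.
    by apply: eq_seg seg_code => z ?; apply: below; lia.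
  move=> c; rewrite pos1; last by apply: map_f; exact: mem_ranking.
  by rewrite index_map //; exact: rank_inj.
- rewrite T_leaves; lia.
- rewrite T_leaves; lia.
- lia.
rewrite T_leaves in c_le; rewrite add0n T_leaves in loop.
set s1 := st _ M2 in loop.
pose s2 := st (regs m (5 * m) (7 * m) (cost (position v) T)
  (m.+1 + size (tree_code T)) (6 * m + m) (7 * m) 2 tm2) M2.
(* With the stack empty, the last return switches to mode 2: two tests and an assignment. *)
have run3 : runs W step s1 3 s2.
  by apply: runs_if_true => //; apply: runs_if_false => //; apply: wp_runs.
have run4 : runs W (While rMode rTwo step) s1 5 s2.
  by apply: (runs_while_true _ run3) => //; apply: runs_while_false.
exists s2; split; last by rewrite swap_set_cost.
have run5 := runs_seq (runs_seq run1 run2) (loop _ _ run4).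
(* Setup and positions cost [6 * m + 11], the tree less than [80 * m ^ 2]; 200 leaves a wide
   margin. *)
by apply: runs_le run5; rewrite names_size -mulnn; nia.
Qed.

(* Words have O(log m) bits: they range below k * m ^ k. *)
Theorem theorem4p7 :
  exists (p : prog) (a k : nat),
  forall (C : finType) (T : tree C) (v : ranking C),
    gs_tree T ->
    exists (t : nat) (s : state),
      [/\ exec (k * #|C| ^ k) p (init T v) t s,
          output s = swap_set (GS T) v
        & t <= a * #|C| ^ 2].
Proof.
exists gs_swap, 200, 20 => C T v T_gs.
have [s [[t run t_le] out]] := gs_swap_run v T_gs.
by exists t, s.
Qed.
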